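(* There is a compact space $K$ with the following properties: (1) $K$ is homeomorphic to a growth of $\omega$; (2) $K$ is non-separable; (3) $K$ is ccc; (4) $K$ is linearly-fibered and scatteredly-fibered; (5) $K$ has countable $\pi$-character; and such that $K$ does not support a measure. Moreover, $K$ is $\sigma$-$n$-linked for every $n$.
   Context: The result is in ZFC. A compactification of $\omega$ (with the discrete topology) is a compact (Hausdorff) space $L\supseteq\omega$ in which $\omega$ is a dense (discrete) subspace; a growth of $\omega$ is a space of the form $L\setminus\omega$, where $L$ is a compactification of $\omega$. A space is ccc if every family of pairwise disjoint nonempty open sets is countable. A compact space $K$ supports a measure if there is a (finite Radon) measure $\mu$ on $K$ with $\mu(U)>0$ for every nonempty open $U\subseteq K$. A space $K$ has countable $\pi$-character if each $x\in K$ has a countable local $\pi$-base, i.e. a countable family $\mathcal{U}_x$ of nonempty open sets such that each neighbourhood of $x$ contains an element of $\mathcal{U}_x$. A space $K$ is scatteredly-fibered if there is a continuous function $f\colon K\to M$ into a metric space $M$ such that each fiber $f^{-1}[x]$ is a scattered space; it is linearly-fibered if there is a continuous function $f\colon K\to M$ into a metric space $M$ such that each fiber $f^{-1}[x]$ is a linearly ordered topological space (i.e. its topology is the order topology of some linear order). For an integer $n\geq 1$, a space $K$ is $\sigma$-$n$-linked if the family of its nonempty open sets is a countable union $\bigcup_{m<\omega}\mathcal{C}_m$ such that, for each $m$, any $n$ members of $\mathcal{C}_m$ have nonempty intersection. *)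

(* Defs.v *)
From HB Require Import structures.
From mathcomp Require Import all_boot all_order all_algebra.
From mathcomp Require Import all_classical all_reals all_analysis.

Set Implicit Arguments.
Unset Strict Implicit.
Unset Printing Implicit Defensive.

Import Order.TTheory GRing.Theory Num.Theory.

Local Open Scope classical_set_scope.
Local Open Scope ring_scope.

Definition homeomorphic (S T : topologicalType) : Prop :=
  exists (f : S -> T) (g : T -> S),
    [/\ cancel f g, cancel g f, continuous f & continuous g].

Definition compact_hausdorff (K : topologicalType) : Prop :=
  compact [set: K] /\ hausdorff_space K.

(* [W] is the copy of omega inside the compactification [L]; [nat] carries the
   discrete topology, and a set used as a type carries the subspace topology. *)
Definition compactification_of_omega (L : topologicalType) (W : set L) : Prop :=
  [/\ compact_hausdorff L, homeomorphic nat (set_type W) & dense W].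

Definition homeomorphic_to_growth_of_omega (K : topologicalType) : Prop :=
  exists (L : topologicalType) (W : set L),
    compactification_of_omega W /\ homeomorphic K (set_type (~` W)).

Definition separable (K : topologicalType) : Prop :=
  exists2 D : set K, countable D & dense D.

Definition nonempty_open (K : topologicalType) : set (set K) :=
  [set U | open U /\ U !=set0].

Definition ccc (K : topologicalType) : Prop :=
  forall F : set (set K),
    F `<=` @nonempty_open K -> trivIset F id -> countable F.

Definition countable_pi_character (K : topologicalType) : Prop :=
  forall x : K, exists B : set (set K),
    [/\ countable B, B `<=` @nonempty_open K &
        forall N, nbhs x N -> exists2 V, B V & V `<=` N].

Definition scattered (T : topologicalType) : Prop :=
  forall A : set T, A !=set0 -> isolated A !=set0.

Definition linearly_ordered_space (T : topologicalType) : Prop :=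
  exists (d : Order.disp_t) (O : orderTopologicalType d), homeomorphic T O.

Definition scatteredly_fibered (R : realType) (K : topologicalType) : Prop :=
  exists (M : metricType R) (f : K -> M),
    continuous f /\ forall x : M, scattered (set_type (f @^-1` [set x])).

Definition linearly_fibered (R : realType) (K : topologicalType) : Prop :=
  exists (M : metricType R) (f : K -> M),
    continuous f /\
    forall x : M, linearly_ordered_space (set_type (f @^-1` [set x])).

(* The library's measurable types are pointed, hence [ptopologicalType] here. *)
Definition borel (K : ptopologicalType) := g_sigma_algebraType (@open K).

Definition radon (R : realType) (K : ptopologicalType)
    (mu : {finite_measure set (borel K) -> \bar R}) : Prop :=
  forall B : set (borel K), measurable B ->
    mu B = ereal_sup [set mu C | C in [set C | @compact K C /\ C `<=` B]].

Definition supports_measure (R : realType) (K : ptopologicalType) : Prop :=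
  exists mu : {finite_measure set (borel K) -> \bar R},
    radon mu /\ forall U : set K, open U -> U !=set0 -> (0 < mu U)%E.

(* The [n] members of [C m] may repeat. This does not affect the notion: a
   [C m] with fewer than [n] members can be replaced by its singletons. *)
Definition sigma_n_linked (n : nat) (K : topologicalType) : Prop :=
  exists C : nat -> set (set K),
    @nonempty_open K = \bigcup_m C m /\
    forall (m : nat) (U : 'I_n -> set K),
      (forall i, C m (U i)) -> \bigcap_(i in [set: 'I_n]) U i !=set0.

(* Main.v *)
(* Call a set of naturals light if its harmonic mass, the sum of [1 / (k + 1)]
   over its elements, is finite. Light sets are countably directed by almost
   inclusion and have no maximum, so there is an almost-inclusion wellordered
   family [C] of them without a light upper bound. Let the nodes be the finite
   binary sequences of mass below 1, and for [A] in [C] let [T_A] be the tree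
   of those nodes [s] which contain [A] below [size s] and for which adding the
   rest of [A] keeps the mass below 1. Close the nodes in the cube whose
   coordinates are the cones of the binary tree and the sets [T_A], [A] in [C].
   The remainder is the required growth.

   Every point [x] of the growth lies over a branch, a set of mass at most 1
   which contains each [A] whose [T_A] belongs to [x]. A countable dense set
   would thus bound [C] by countably many light branches, hence by one light
   set. A strictly positive measure [mu] would do the same with the sets
   [{k | mu {x | k in branch x} >= 1 / (j + 1)}], which are light because the
   mass of a branch integrates to at most [mu K]. Over a fixed branch the trees
   [T_A] are linearly ordered by inclusion, in the reverse of the order of [C],
   so the fibers of the branch map are wellordered chains of initial segments
   and are both linearly ordered and scattered. The cones of [T_A], [A] in [C],
   form a pi-base, and [n] of them over the same node meet as soon as the
   masses beyond that node add up to less than the room left below 1. *)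
Require Import Defs.
From HB Require Import structures.
From mathcomp Require Import all_boot all_order all_algebra.
From mathcomp Require Import all_classical all_reals all_analysis.
From mathcomp Require Import measurable_realfun lra.

Set Implicit Arguments.
Unset Strict Implicit.
Unset Printing Implicit Defensive.

Import Order.TTheory GRing.Theory Num.Theory.

Local Open Scope classical_set_scope.
Local Open Scope ring_scope.

(** * Light sets *)

Definition almost_subset (A B : set nat) : Prop :=
  exists m, forall k, (m <= k)%N -> A k -> B k.

Lemma almost_subset_refl (A : set nat) : almost_subset A A.
Proof. by exists 0%N. Qed.

Lemma subset_almost (A B : set nat) : A `<=` B -> almost_subset A B.
Proof. by move=> AB; exists 0%N => k _; exact: AB. Qed.

Lemma almost_subset_trans (A B D : set nat) :
  almost_subset A B -> almost_subset B D -> almost_subset A D.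
Proof.
move=> [m AB] [n BD]; exists (maxn m n) => k; rewrite geq_max =>
  /andP[mk nk] Ak.
exact/BD/AB.
Qed.

Section Mass.
Context {R : realType}.
Implicit Types (A B : set nat) (m n k : nat).

Definition mass A m : R :=
  \sum_(k < m) if (k : nat) \in A then k.+1%:R^-1 else 0.

Definition light A : Prop := exists c, forall m, mass A m <= c.

(** The bound [c] is uniform and strictly below 1: the room [1 - c] is what later extensions
    spend. *)
Definition small A : Prop := exists2 c, c < 1 & forall m, mass A m <= c.

Let wge0 k : 0 <= k.+1%:R^-1 :> R. Proof. by rewrite invr_ge0. Qed.
#[local] Hint Resolve wge0 : core.

Lemma subset_mass A B m : A `<=` B -> mass A m <= mass B m.
Proof.
move=> AB; apply: ler_sum => k _.
case: ifPn => [/set_mem/AB/mem_set -> //|_]; by case: ifP.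
Qed.

Lemma massU A B m : mass (A `|` B) m <= mass A m + mass B m.
Proof.
rewrite -big_split /=; apply: ler_sum => k _; rewrite in_setU.
by case: (_ \in A); case: (_ \in B); rewrite /= ?addr0 ?add0r ?lerDl.
Qed.

Lemma massUI0 A B m : A `&` B = set0 -> mass (A `|` B) m = mass A m + mass B m.
Proof.
move=> AB0; rewrite -big_split /=; apply: eq_bigr => k _; rewrite in_setU.
case: (boolP (_ \in A)) => [kA|]; case: (boolP (_ \in B)) => [kB|];
  rewrite /= ?addr0 ?add0r//.
by have : set0 (k : nat) by rewrite -AB0; split; exact: set_mem.
Qed.

Lemma mass_setI A m n : (m <= n)%N -> mass (A `&` `I_m) n = mass A m.
Proof.
move=> mn; rewrite [RHS](big_ord_widen n (fun k =>
  if k \in A then k.+1%:R^-1 else 0)) //=.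
rewrite [RHS]big_mkcond /=; apply: eq_bigr => k _; rewrite in_setI.
have -> : ((k : nat) \in `I_m) = (k < m)%N by apply/idP/idP =>
  [/set_mem|/mem_set].
by case: (_ \in A); case: (k < m)%N.
Qed.

Lemma mass_le A m n : (m <= n)%N -> mass A m <= mass A n.
Proof. by move=> mn; rewrite -(mass_setI A mn); exact: subset_mass. Qed.

Lemma subset_light A B : A `<=` B -> light B -> light A.
Proof. by move=> AB [c Bc]; exists c => m;
  exact/(le_trans (subset_mass m AB)). Qed.

Lemma subset_small A B : A `<=` B -> small B -> small A.
Proof. by move=> AB [c c1 Bc]; exists c => // m;
  exact/(le_trans (subset_mass m AB)). Qed.

Lemma lightU A B : light A -> light B -> light (A `|` B).
Proof.
move=> [c Ac] [d Bd]; exists (c + d) => m; apply: le_trans (massU _ _ _) _.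
exact: lerD.
Qed.

Lemma light_II m : light `I_m.
Proof.
exists (mass setT m) => n; have [mn|/ltnW nm] := leqP m n.
  by rewrite -(setTI `I_m) mass_setI.
by apply: le_trans (mass_le _ nm) _; exact: subset_mass.
Qed.

Lemma light_almost A B : almost_subset A B -> light B -> light A.
Proof.
move=> [m AB] lB; apply: (@subset_light _ (`I_m `|` B)).
  by move=> k Ak; have [km|mk] := ltnP k m; [left|right; exact: AB].
exact: lightU (light_II m) lB.
Qed.

(** The partial masses come within [e] of their supremum at some [m], so at most [e] is left beyond
    [m]. *)
Lemma light_tail A (e : R) : light A -> 0 < e ->
  exists m, forall n, mass (A `\` `I_m) n <= e.
Proof.
move=> [c Ac] e0.
have hs : has_sup (range (mass A)).
  by split; [exists (mass A 0), 0%N | exists c => _ [m _ <-]].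
have [_ [m _ <-] em] := sup_adherent e0 hs.
(* Passing from [n] to [maxn m n] lets the mass split at [m]. *)
exists m => n; apply: (@le_trans _ _ (mass (A `\` `I_m) (maxn m n))).
  by apply: mass_le; exact: leq_maxr.
have : mass A (maxn m n) <= sup (range (mass A)) by apply: sup_upper_bound =>
  //; exists (maxn m n).
have -> : mass A (maxn m n) = mass A m + mass (A `\` `I_m) (maxn m n).
  rewrite -(mass_setI A (leq_maxl m n)) -massUI0; last first.
    by rewrite -subset0 => k [[_ km] [_]]; apply.
  by congr (mass _ _); rewrite setDE -setIUr setUv setIT.
lra.
Qed.

Lemma mass_fin_bigcup (I : finType) (A : I -> set nat) m :
  mass (\bigcup_i A i) m <= \sum_i mass (A i) m.
Proof.
rewrite /mass exchange_big /=; apply: ler_sum => k _.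
case: ifPn => [/set_mem[i _ Aik]|_]; last by apply: sumr_ge0 => i _; case: ifP.
rewrite (bigD1 i) //= mem_set// lerDl.
by apply: sumr_ge0 => j _; case: ifP.
Qed.

(** Only finitely many of the sets are needed to cover the part of the union below [m], so finite
    subadditivity suffices. *)
Lemma mass_bigcup (A : nat -> set nat) (c : nat -> R) (b : R) :
  (forall i m, mass (A i) m <= c i) -> (forall n, \sum_(i < n) c i <= b) ->
  forall m, mass (\bigcup_i A i) m <= b.
Proof.
move=> Ac cb m.
have [N HN] : exists N, forall k, (k < m)%N -> (\bigcup_i A i) k ->
    exists2 i, (i < N)%N & A i k.
  elim: m => [|m [N IH]]; first by exists 0%N.
  have [[i _ Aim]|nA] := pselect ((\bigcup_i A i) m).
    exists (maxn N i.+1) => k; rewrite ltnS leq_eqVlt => /predU1P[-> _|km Ak].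
      by exists i => //; rewrite leq_max ltnSn orbT.
    by have [j jN Aj] := IH _ km Ak; exists j => //; rewrite leq_max jN.
  by exists N => k; rewrite ltnS leq_eqVlt => /predU1P[->//|]; exact: IH.
apply: le_trans (cb N); rewrite -(mass_setI _ (leqnn m)).
apply: (@le_trans _ _ (mass (\bigcup_(i : 'I_N) A i) m)).
  apply: subset_mass => k [Ak km]; have [i iN Aik] := HN _ km Ak.
  by exists (Ordinal iN).
by apply: le_trans (mass_fin_bigcup _ _) _; exact: ler_sum.
Qed.

Lemma sum_half n : \sum_(i < n) (2^-1) ^+ i.+1 <= 1 :> R.
Proof.
suff -> : \sum_(i < n) (2^-1) ^+ i.+1 = 1 - (2^-1) ^+ n :> R.
  by rewrite lerBlDr lerDl exprn_ge0.
elim: n => [|n IH]; first by rewrite big_ord0 expr0 subrr.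
by rewrite big_ord_recr /= IH exprS; lra.
Qed.

(** Cut a finite head off each [A i] so that the tail has mass at most [2^-(i+1)]; the union of the
    tails is light. *)
Lemma light_upper_bound (A : nat -> set nat) : (forall i, light (A i)) ->
  exists2 B, light B & forall i, almost_subset (A i) B.
Proof.
move=> lA.
have /choice[f Hf] i : exists m, forall n,
  mass (A i `\` `I_m) n <= (2^-1) ^+ i.+1.
  by apply: light_tail => //; rewrite exprn_gt0.
exists (\bigcup_i (A i `\` `I_(f i))).
  by exists 1; exact: (mass_bigcup Hf sum_half).
move=> i; exists (f i) => k fk Ak; exists i => //; split => //=.
by rewrite ltnNge fk.
Qed.

(** Otherwise all of [nat] would be light, and the harmonic series would converge. *)
Lemma light_coinfinite B m : light B -> exists2 k, (m <= k)%N & ~ B k.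
Proof.
move=> lB; apply: contrapT => nk.
have : light setT.
  apply: light_almost lB; exists m => k mk _.
  by apply: contrapT => nB; apply: nk; exists k.
move=> [c Hc]; apply: (@dvg_harmonic R); apply: nondecreasing_is_cvgn.
  by apply: nondecreasing_series => k _ _; exact: harmonic_ge0.
exists c => _ [n _ <-]; apply: le_trans (Hc n).
rewrite /series /= big_mkord /mass.
by apply: ler_sum => k _; rewrite in_setT.
Qed.

Lemma mass_set1 k m : mass [set k] m <= k.+1%:R^-1.
Proof.
rewrite /mass; have [mk|km] := leqP m k.
  rewrite big1 // => i _; rewrite memNset//= => ik; move: (ltn_ord i).
  by rewrite ik ltnNge mk.
rewrite (bigD1 (Ordinal km)) //= mem_set// big1 ?addr0// => i ik.
rewrite memNset//= => eik; move/eqP: ik; apply; exact: val_inj.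
Qed.

(** Add to [B] missing points [f n >= 2^(n+1)]: their weights are dominated by a geometric series,
    yet they are unbounded. *)
Lemma light_no_max B : light B ->
  exists B', [/\ light B', B `<=` B' & ~ almost_subset B' B].
Proof.
move=> lB; have /choice[f Hf] n : exists k, (2 ^ n.+1 <= k)%N /\ ~ B k.
  by have [k k1 k2] := light_coinfinite (2 ^ n.+1) lB; exists k.
exists (B `|` \bigcup_n [set f n]); split.
- apply: lightU => //; exists 1; apply: (mass_bigcup (c := fun i =>
    (2^-1) ^+ i.+1) _ sum_half) => n m.
  apply: le_trans (mass_set1 _ _) _ => /=.
  rewrite exprVn lef_pV2 ?posrE ?exprn_gt0// -natrX ler_nat.
  by apply: leq_trans (Hf n).1 _.
- exact: subsetUl.
(* As [f m] exceeds [m] and avoids [B], it refutes the threshold [m]. *)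
- move=> [m Hm]; apply: (Hf m).2; apply: Hm; last by right; exists m.
  apply: leq_trans (Hf m).1; apply: ltnW;
    exact: ltn_trans (ltnSn m) (ltn_expl _ _).
Qed.

(** Half of the room [1 - c] is given to a tail of [D], the other half stays free. *)
Lemma small_tail A D m0 : small A -> light D ->
  exists2 m, (m0 <= m)%N & small (A `|` (D `\` `I_m)).
Proof.
move=> [c c1 Ac] lD; have e0 : 0 < (1 - c) / 2 by lra.
have [m Hm] := light_tail lD e0.
exists (maxn m0 m); first exact: leq_maxl.
exists (c + (1 - c) / 2); first by lra.
move=> n; apply: le_trans (massU _ _ _) _; apply: lerD => //.
apply: le_trans (Hm n); apply: subset_mass => k [Dk /= kn]; split => //= km.
by apply: kn; rewrite leq_max km orbT.
Qed.

End Mass.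
Arguments light R A : clear implicits.
Arguments small R A : clear implicits.

(** * Unbounded wellordered chains of light sets *)

Definition almost_wellordered (C : set (set nat)) : Prop :=
  forall S, S `<=` C -> S !=set0 ->
    exists2 D, S D & forall A, S A -> almost_subset D A.

Section Chain.
Context (R : realType).
Local Notation light := (light R).

(** Closure under finite changes allows heads to be cut off the members of [C]; the member [set0]
    yields the tree of all nodes. *)
Record unbounded_chain (C : set (set nat)) : Prop := UnboundedChain {
  chain_light : C `<=` light;
  chain0 : C set0;
  chain_almost : forall A B,
    C A -> almost_subset A B -> almost_subset B A -> C B;
  chain_well : almost_wellordered C;
  chain_unbounded : forall B, light B -> exists2 A, C A & ~ almost_subset A B }.

Let chain := {C : set (set nat) | C `<=` light /\ almost_wellordered C}.

(** New members must lie above all old ones; plain inclusion would not keep unions of chains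
    wellordered. *)
Let end_extension : rel chain := fun C D => `[< sval C `<=` sval D /\
  forall A B, sval C A -> sval D B -> ~ sval C B -> almost_subset A B >].

(** A chain maximal for end extension is unbounded: above a light bound there would be a strictly
    larger light set to append. *)
Lemma exists_unbounded_wellordered : exists C : set (set nat),
  [/\ C `<=` light, almost_wellordered C &
      forall B, light B -> exists2 A, C A & ~ almost_subset A B].
Proof.
have [||||[C [Cl Cw]] Cmax] := @Zorn chain end_extension.
- by move=> C; apply/asboolP; split => // A B _ CB /(_ CB).
- move=> C D E /asboolP[CD hCD] /asboolP[DE hDE]; apply/asboolP; split.
    exact: subset_trans DE.
  move=> A B CA EB nCB; have [DB|nDB] := pselect (sval D B); first exact: hCD.
  by apply: hDE => //; exact: CD.
- move=> [C HC] [D HD] /asboolP[/= CD _] /asboolP[/= DC _].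
  by apply: eq_exist; apply/seteqP.
- move=> F tF; pose U := \bigcup_(C in F) sval C.
  have Ul : U `<=` light by move=> A [C _ CA]; exact: (svalP C).1.
  have Uw : almost_wellordered U.
    (* The least element of [S] within one stage [C] that meets [S] is least in all of [S], because
       later stages only add sets above [C]. *)
    move=> S SU [A SA]; have [C FC CA] := SU _ SA.
    have [||D [SD CD] Dmin] := (svalP C).2 (S `&` sval C).
    - by move=> B [].
    - by exists A.
    exists D => // B SB; have [C' FC' CB] := SU _ SB.
    have [/asboolP[_ h]|/asboolP[h _]] := tF _ _ FC FC'.
      have [CB'|nCB] := pselect (sval C B); first exact: Dmin.
      exact: h.
    by apply: Dmin; split => //; exact: h.
  exists (exist _ U (conj Ul Uw)) => C FC; apply/asboolP => /=.
  split; first by move=> A CA; exists C.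
  move=> A B CA [C' FC' CB] nCB.
  have [/asboolP[_ h]|/asboolP[h _]] := tF _ _ FC FC'; first exact: h.
  by case: nCB; exact: h.
- exists C; split => // B lB; apply: contrapT => nB.
  have [B' [lB' BB' nB'B]] := light_no_max lB.
  have CB A : C A -> almost_subset A B by move=> CA; apply: contrapT => nA;
    apply: nB; exists A.
  have CB' A : C A -> almost_subset A B'.
    move=> /CB AB; apply: almost_subset_trans AB _; exact: subset_almost.
  have nCB' : ~ C B' by move=> /CB.
  have Dl : C `|` [set B'] `<=` light by move=> A [/Cl//|->].
  have Dw : almost_wellordered (C `|` [set B']).
    (* Either [S] meets [C], whose elements all lie below [B'], or [S] consists of [B'] alone. *)
    move=> S SD [A0 SA0]; have [[A [SA CA]]|nS] := pselect (S `&` C !=set0).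
      have [||D [SE CE] Dmin] := Cw (S `&` C); [by move=> ? []|by exists A|].
      exists D => // E /[dup] SE' /SD[CE'|->]; [exact: Dmin|exact: CB'].
    have SB' E : S E -> E = B'.
      by move=> /[dup] SE' /SD[CE|//]; case: nS; exists E.
    exists B'; first by rewrite -(SB' _ SA0).
    by move=> E /SB' ->; exact: almost_subset_refl.
  have /Cmax/(congr1 sval) /= e :
      end_extension (exist _ C (conj Cl Cw)) (exist _ _ (conj Dl Dw)).
    apply/asboolP; split => /=; first exact: subsetUl.
    by move=> A E CA [//|->] _; exact: CB'.
  by apply: nCB'; rewrite -e; right.
Qed.

(** Add [set0] to the wellordered family and close it under finite changes. *)
Lemma exists_unbounded_chain : exists C, unbounded_chain C.
Proof.
have [C [Cl Cw Cu]] := exists_unbounded_wellordered.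
pose C' : set (set nat) := [set A | exists2 D, D = set0 \/ C D &
  almost_subset A D /\ almost_subset D A].
exists C'; split.
- move=> A [D [->|CD] [AD _]]; apply: light_almost AD _; last exact: Cl.
  by apply: subset_light (@light_II R 0) => ? [].
- by exists set0; [left|split; exact: almost_subset_refl].
- move=> A B [D CD [AD DA]] AB BA; exists D => //.
  by split; [exact: almost_subset_trans AD|exact: almost_subset_trans AB].
- move=> S SC' [A SA].
  (* A finite member of [S] lies below everything. If there is none, minimize over the
     representatives in [C] of the members of [S]. *)
  have [[E [SE E0]]|n0] := pselect (exists E, S E /\ almost_subset E set0).
    exists E => // B SB; apply: almost_subset_trans E0 _; exact: subset_almost.
  have CS E : S E -> exists D, [/\ C D, almost_subset E D & almost_subset D E].
    move=> /[dup] SE /SC'[D [->|CD] [ED DE]]; last by exists D.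
    by case: n0; exists E.
  pose S1 := [set D | C D /\ exists E, [/\ S E,
    almost_subset E D & almost_subset D E]].
  have [||D [CD [E [SE ED DE]]] Dmin] := Cw S1.
  + by move=> D [].
  + by have [D [CD AD DA]] := CS _ SA; exists D; split => //; exists A.
  exists E => // B SB; have [D' [CD' BD' DB']] := CS _ SB.
  apply: almost_subset_trans ED _; apply: (almost_subset_trans _ DB').
  by apply: Dmin; split => //; exists B.
- move=> B /Cu[A CA nAB]; exists A => //; exists A; [by right|].
  by split; exact: almost_subset_refl.
Qed.

Lemma chain_total C A B : unbounded_chain C -> C A -> C B ->
  almost_subset A B \/ almost_subset B A.
Proof.
move=> hC CA CB; have [||D [->|->] H] := chain_well hC (S := [set A; B]).
- by move=> ? [->|->].
- by exists A; left.
- by left; apply: H; right.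
- by right; apply: H; left.
Qed.

End Chain.

(** * Nodes and the trees [T_A] *)

Definition ones (s : seq bool) : set nat := [set k | nth false s k].

Definition graft (s : seq bool) (A : set nat) : set nat :=
  ones s `|` (A `\` `I_(size s)).

Definition trunc (A : set nat) (m : nat) : seq bool := mkseq (mem A) m.

Lemma prefix_nthP (s t : seq bool) : prefix s t <->
  (size s <= size t)%N /\ forall k, (k < size s)%N ->
    nth false t k = nth false s k.
Proof.
split=> [/prefixP[u ->]|[st H]].
  by rewrite size_cat leq_addr; split => // k ks; rewrite nth_cat ks.
rewrite prefixE; apply/eqP/(@eq_from_nth _ false); rewrite size_takel//.
by move=> k ks; rewrite nth_take//; exact: H.
Qed.

Lemma ones_size (s : seq bool) k : ones s k -> (k < size s)%N.
Proof. by rewrite /ones /= => sk; rewrite ltnNge; apply: contraL sk => ?;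
  rewrite nth_default. Qed.

Lemma prefix_ones (s t : seq bool) : prefix s t ->
  ones s = ones t `&` `I_(size s).
Proof.
move=> /prefix_nthP[st H]; apply/seteqP; split => k /=.
  by move=> /[dup] sk /ones_size ks; split => //; rewrite /ones /= H.
by move=> [tk ks]; rewrite /ones /= -H.
Qed.

Lemma size_trunc A m : size (trunc A m) = m.
Proof. exact: size_mkseq. Qed.

Lemma ones_trunc A m : ones (trunc A m) = A `&` `I_m.
Proof.
apply/seteqP; split => k.
  move=> /[dup] /ones_size; rewrite size_trunc => km.
  by rewrite /ones /= nth_mkseq// => /set_mem.
by move=> [Ak km]; rewrite /ones /= nth_mkseq//; exact: mem_set.
Qed.

Lemma graft_lt s A k : (k < size s)%N -> graft s A k = ones s k.
Proof.
move=> ks; apply/propext; split; last by left.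
by move=> [//|[_]]; rewrite /= ks.
Qed.

Lemma prefix_trunc s A m : (size s <= m)%N -> prefix s (trunc (graft s A) m).
Proof.
move=> sm; apply/prefix_nthP; rewrite size_trunc; split => // k ks.
rewrite nth_mkseq; last exact: leq_trans sm.
apply/idP/idP => [/set_mem|]; first by rewrite graft_lt.
by move=> sk; apply/mem_set; rewrite graft_lt.
Qed.

Section Subtree.
Context (R : realType).
Local Notation light := (light R).
Local Notation small := (small R).

Definition subtree (A : set nat) : set (seq bool) :=
  [set s | A `&` `I_(size s) `<=` ones s /\ small (graft s A)].

Lemma subtree_graft A s : subtree A s -> A `<=` graft s A.
Proof.
move=> [As _] k Ak; have [ks|sk] := ltnP k (size s); first by left; exact: As.
by right; split => //=; rewrite ltnNge sk.
Qed.

Lemma subtree_prefix A s t : prefix s t -> subtree A t -> subtree A s.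
Proof.
move=> /[dup] /prefix_nthP[st _] /prefix_ones st1 [At tA]; split.
  move=> k [Ak ks]; rewrite st1; split => //; apply: At; split => //=.
  exact: leq_trans st.
apply: subset_small tA => k [sk|[Ak ks]]; first by left; move: sk;
  rewrite st1 => -[].
have [kt|tk] := ltnP k (size t); first by left; exact: At.
by right; split => //=; rewrite ltnNge tk.
Qed.

Lemma subtree_trunc A B m : small B -> A `<=` B -> subtree A (trunc B m).
Proof.
move=> sB AB; split; rewrite ?size_trunc /graft ones_trunc ?size_trunc.
  by move=> k [/AB].
by apply: subset_small sB => k [[]//|[/AB]].
Qed.

(** This reverses the order: a larger set leaves less room for mass, so beyond the threshold [m] the
    tree of [B] is contained in that of [A], among nodes which already contain [A] below their
    length. *)
Lemma subtree_almost A B m t : (forall k, (m <= k)%N -> A k -> B k) ->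
  (m <= size t)%N -> A `&` `I_(size t) `<=` ones t -> subtree B t ->
    subtree A t.
Proof.
move=> AB mt At [_ tB]; split => //; apply: subset_small tB.
move=> k [tk|[Ak /= kt]]; first by left.
by right; split => //=; apply: AB => //; apply: leq_trans mt _; rewrite leqNgt;
  apply/negP.
Qed.

Lemma subtree_sub A B t : A `<=` B -> subtree B t -> subtree A t.
Proof.
move=> AB [Bt tB]; split; first by move=> k [/AB Bk kt]; exact: Bt.
by apply: subset_small tB => k [tk|[/AB Ak kt]]; [left|right].
Qed.

Lemma subtree0E s : subtree set0 s = small (ones s).
Proof.
rewrite /subtree /= /graft set0D setU0; apply/propext; split => [[]//|H].
by split => // k [].
Qed.

Lemma subtree_ext A s m : subtree A s -> subtree A (trunc (graft s A) m).
Proof. by move=> As; apply: subtree_trunc;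
  [exact: As.2|exact: subtree_graft]. Qed.

End Subtree.

(** * The cube *)

Definition cube_index := (seq bool + set nat)%type.

Definition cube := prod_topology (fun _ : cube_index => bool).

(** The filter generated by the finite cylinders around [z] converges to [z] in every coordinate,
    hence in the product topology. *)
Lemma cube_nbhs (z : cube) (U : set cube) : nbhs z U ->
  exists F : seq cube_index, forall y, (forall j, j \in F -> y j = z j) -> U y.
Proof.
pose G := filter_from [set: seq cube_index] (fun F => [set y : cube | forall j,
  j \in F -> y j = z j]).
have FG : Filter G.
  apply: filter_from_filter; first by exists [::].
  move=> F1 F2 _ _; exists (F1 ++ F2) => // y Hy.
  by split => j jF; apply: Hy; rewrite mem_cat jF ?orbT.
have Gz : G --> z.
  apply/cvg_sup => j A [_ [[V oV <-] /= Vz VA]].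
  exists [:: j] => // y Hy; apply: VA => /=; rewrite Hy ?mem_seq1//.
by move=> /Gz[F _ FU]; exists F => y; exact: FU.
Qed.

Lemma cube_proj_continuous (j : cube_index) : continuous (fun z : cube => z j).
Proof. exact: (@proj_continuous _ (fun _ : cube_index => bool) j). Qed.

Lemma cube_coord_open (j : cube_index) b : open [set z : cube | z j = b].
Proof.
apply: (@open_comp _ _ (fun z : cube => z j) [set b]).
  by move=> z _; exact: cube_proj_continuous.
exact: discrete_open.
Qed.

Lemma cube_compact : compact [set: cube].
Proof.
have := @tychonoff cube_index (fun _ => bool) _ (fun=> bool_compact).
by congr (compact _); rewrite eqEsubset; split => b //=.
Qed.

Lemma cube_hausdorff : hausdorff_space cube.
Proof. by apply: hausdorff_product => ?; exact: discrete_hausdorff. Qed.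

Lemma set_type_compact (T : topologicalType) (A : set T) :
  compact A -> compact [set: set_type A].
Proof.
move=> cA F FF _.
have [] := cA (fmap set_val F) (fmap_proper_filter set_val FF).
  by apply: (@filterE _ F) => x; exact: set_valP.
move=> z [Az Hz]; exists (exist _ z (mem_set Az)); split => //.
move=> P U FP [_ [[V oV <-] Vz VU]].
have [x [[p Pp px] Vx]] := Hz (set_val @` P) V
  (filterS (@preimage_image _ _ set_val P) FP) (open_nbhs_nbhs (conj oV Vz)).
by exists p; split => //; apply: VU => /=; rewrite px.
Qed.

Lemma set_type_hausdorff (T : topologicalType) (A : set T) :
  hausdorff_space T -> hausdorff_space (set_type A).
Proof.
move=> hT p q pq; apply: val_inj; apply: hT => U V Up Vq.
have [x [Ux Vx]] := pq (set_val @^-1` U) (set_val @^-1` V)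
  (initial_continuous Up) (initial_continuous Vq).
by exists (set_val x).
Qed.

(** * The compactification and its growth *)

Lemma cube_cylinder_nbhs (z : cube) (F : seq cube_index) :
  nbhs z [set y | forall j, j \in F -> y j = z j].
Proof.
elim: F => [|j F IH]; first by apply: filterE.
have : nbhs z [set y : cube | y j = z j].
  by apply: open_nbhs_nbhs; split => //; exact: cube_coord_open.
apply: filterS2 IH => y yF yj i; rewrite inE => /predU1P[->//|]; exact: yF.
Qed.

(** Finiteness of the short sequences lets one finite list of coordinates deal with all of them. *)
Lemma short_seqs (m : nat) : exists ts : seq (seq bool),
  forall t, (size t <= m)%N -> t \in ts.
Proof.
elim: m => [|m [ts IH]]; first by exists [:: [::]] => -[].
exists ([::] :: map (cons true) ts ++ map (cons false) ts) => -[//|b t] /= bt.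
by rewrite inE mem_cat; case: b bt => bt; rewrite map_f ?orbT// IH.
Qed.

Section Space.
Context (R : realType) (C : set (set nat)).

(** Every set of naturals indexes a coordinate; those outside [C] get the empty cell. *)
Definition cell (j : cube_index) : set (seq bool) :=
  match j with
  | inl s => [set t | prefix s t]
  | inr A => [set t | C A /\ subtree R A t]
  end.

Definition nodes : set (seq bool) := [set t | small R (ones t)].

Definition node_point (t : seq bool) : cube := fun j => t \in cell j.

Definition compactification : set cube := closure (node_point @` nodes).

Definition isolated_part : set compactification :=
  [set l | (node_point @` nodes) (val l)].

Definition growth := set_type (~` isolated_part).

Definition coord (x : growth) : cube := val (val x).

Lemma pointP t j : reflect (cell j t) (node_point t j).
Proof. by apply: (iffP idP) => [/set_mem|/mem_set]. Qed.

Lemma point_cone t s : node_point t (inl s) = prefix s t.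
Proof. exact/pointP/idP. Qed.

Lemma compactification_approx z (F : seq cube_index) : compactification z ->
  exists2 t, nodes t & forall j, j \in F -> z j = node_point t j.
Proof.
move=> /(_ _ (cube_cylinder_nbhs z F))[_ [[t nt <-] Ht]].
by exists t => // j /Ht.
Qed.

Lemma point_compactification t : nodes t -> compactification (node_point t).
Proof. by move=> nt; apply: subset_closure; exists t. Qed.

(* [t] is the only node in the cone of [t] and in neither of the cones of its
   two successors *)
Definition fan (t : seq bool) : seq cube_index :=
  [:: inl t; inl (rcons t true); inl (rcons t false)].

Lemma fan_point t u : (forall j, j \in fan t ->
  node_point u j = node_point t j) -> u = t.
Proof.
move=> H; have : prefix t u.
  by rewrite -point_cone H ?point_cone ?prefix_refl// inE eqxx.
move=> /prefixP[[|b v] e]; first by rewrite e cats0.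
suff : prefix (rcons t b) t by move=> /size_prefix; rewrite size_rcons ltnn.
rewrite -point_cone -H; last by case: (b); rewrite !inE eqxx ?orbT.
by rewrite point_cone e -cat_rcons prefix_prefix.
Qed.

Lemma point_inj : injective node_point.
Proof. by move=> s t st; apply: fan_point => j _; rewrite st. Qed.

(** A node approximating [z] on the fan of [t] is [t] itself. Approximating on the fan and one more
    coordinate [j] therefore gives equality at [j]. *)
Lemma fan_isolated t z : compactification z ->
  (forall j, j \in fan t -> z j = node_point t j) -> z = node_point t.
Proof.
move=> cz H; apply: functional_extensionality_dep => j.
have [u nu Hu] := compactification_approx (j :: fan t) cz.
rewrite Hu ?mem_head//; congr (node_point _ j); apply: fan_point => i ti.
by rewrite -H// -Hu// inE ti orbT.
Qed.

Lemma growth_compactification (x : growth) : compactification (coord x).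
Proof. exact/set_mem/(valP (val x)). Qed.

Lemma growth_not_point (x : growth) t : nodes t -> coord x <> node_point t.
Proof. by move=> nt e; have /set_mem := valP x; apply; exists t. Qed.

(** Each of the finitely many short nodes differs from [x] at some coordinate. Adding these
    coordinates to [F] forces the approximating node to be long. *)
Lemma growth_approx (x : growth) (F : seq cube_index) m : exists t,
  [/\ nodes t, (m <= size t)%N & forall j, j \in F ->
    coord x j = node_point t j].
Proof.
have [ts Hts] := short_seqs m.
have [F' HF'] : exists F' : seq cube_index, forall t, t \in ts -> nodes t ->
    exists2 j, j \in F' & coord x j != node_point t j.
  elim: ts {Hts} => [|t ts [F' IH]]; first by exists [::].
  have [nt|nnt] := pselect (nodes t); last first.
    by exists F' => u; rewrite inE => /predU1P[->//|]; exact: IH.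
  have [j xj] : exists j, coord x j != node_point t j.
    apply: contrapT => H; apply: (growth_not_point (x := x) nt).
    apply: functional_extensionality_dep => j; apply/eqP/negPn/negP => xj.
    by apply: H; exists j.
  exists (j :: F') => u; rewrite inE => /predU1P[->|ut] nu.
    by exists j => //; rewrite inE eqxx.
  by have [i iF ?] := IH _ ut nu; exists i => //; rewrite inE iF orbT.
have [t nt Ht] := compactification_approx (F ++ F') (@growth_compactification
  x).
exists t; split => // [|j jF]; last by apply: Ht; rewrite mem_cat jF.
rewrite leqNgt; apply/negP => /ltnW/Hts tts.
have [j jF /eqP] := HF' _ tts nt; apply.
by apply: Ht; rewrite mem_cat jF orbT.
Qed.

Definition branch (x : growth) : set nat :=
  [set k | exists s, [/\ size s = k.+1, ones s k & coord x (inl s)]].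

(** Adding the cones of all sequences of length at most [m] to [F] makes the node agree with the
    branch below [m]. *)
Lemma growth_branch_approx (x : growth) (F : seq cube_index) m : exists t,
  [/\ nodes t, (m <= size t)%N, forall j, j \in F ->
    coord x j = node_point t j &
      branch x `&` `I_m = ones t `&` `I_m].
Proof.
have [ts Hts] := short_seqs m.
have [t [nt mt Ht]] := growth_approx x (F ++ [seq inl s | s <- ts]) m.
exists t; split => // [j jF|]; first by apply: Ht; rewrite mem_cat jF.
have Hs s : (size s <= m)%N -> coord x (inl s) = prefix s t.
  by move=> sm; rewrite Ht ?point_cone// mem_cat map_f ?orbT// Hts.
apply/seteqP; split => k [xk /= km]; split => //.
  have [s [sk ks]] := xk; rewrite Hs ?sk// => /prefix_ones st.
  by have [] : (ones t `&` `I_(size s)) k by rewrite -st.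
exists (take k.+1 t); have sk : size (take k.+1 t) = k.+1.
  by rewrite size_takel//; exact: leq_trans mt.
split => //; first by rewrite /ones /= nth_take.
by rewrite Hs ?sk// prefix_take.
Qed.

Lemma coord_cone (x : growth) s :
  coord x (inl s) <-> ones s = branch x `&` `I_(size s).
Proof.
have [t [nt st Ht ->]] := growth_branch_approx x [:: inl s] (size s).
rewrite Ht ?mem_head// point_cone; split => [/prefix_ones//|ost].
apply/prefix_nthP; split => // k ks; apply/idP/idP.
  move=> tk; have : (ones t `&` `I_(size s)) k by [].
  by rewrite -ost.
by move=> sk; have [] : (ones t `&` `I_(size s)) k by rewrite -ost.
Qed.

Lemma coord_subtree (x : growth) A : coord x (inr A) -> C A /\ A `<=` branch x.
Proof.
move=> xA; split.
  have [t [_ _ Ht]] := growth_approx x [:: inr A] 0%N.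
  by move: xA; rewrite Ht ?mem_head// => /pointP[].
move=> k Ak; have [t [_ kt Ht xt]] := growth_branch_approx x [:: inr A] k.+1.
move: xA; rewrite Ht ?mem_head// => /pointP[_ [At _]].
suff [] : (branch x `&` `I_k.+1) k by [].
by rewrite xt; split; [apply: At|exact: ltnSn].
Qed.

(** Every initial segment of the branch is one of a node, of mass below 1; in the limit only the
    weak inequality survives. *)
Lemma mass_branch (x : growth) m : mass (branch x) m <= 1 :> R.
Proof.
have [t [[c c1 tc] _ _ xt]] := growth_branch_approx x [::] m.
rewrite -(mass_setI _ (leqnn m)) xt; apply: le_trans (ltW c1).
apply: le_trans (tc m); apply: subset_mass; exact: subIsetl.
Qed.

Lemma light_branch (x : growth) : light R (branch x).
Proof. by exists 1; exact: mass_branch. Qed.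

(** The point is a cluster point of the nodes [f m], whose growing lengths keep it away from every
    single node. *)
Lemma exists_growth (f : nat -> seq bool) (F : set cube_index) :
  (forall m, nodes (f m)) -> (forall m, (m <= size (f m))%N) ->
  (forall j m, F j -> cell j (f m)) ->
  exists x : growth, forall j, F j -> coord x j.
Proof.
move=> nf sf Ff.
have [z [_ Hz]] := cube_compact (fmap_proper_filter (node_point \o f) _ :
  ProperFilter (node_point \o f @ \oo)) filterT.
have zapprox (G : seq cube_index) m : exists2 n, (m <= n)%N & forall j,
  j \in G -> node_point (f n) j = z j.
  have := Hz [set node_point (f n) | n in [set n |
    (m <= n)%N]] _ _ (cube_cylinder_nbhs z G).
  case; first by exists m => // n mn; exists n.
  by move=> _ [[n mn <-] H]; exists n.
have cz : compactification z.
  move=> U /cube_nbhs[G HG]; have [n _ Hn] := zapprox G 0%N.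
  by exists (node_point (f n)); split; [exists (f n)|exact: HG].
(* If [z] were the node [t], some [f n] with [n > size t] would agree with [t] on its fan and so
   equal [t], but it is too long. *)
have nz : ~ (node_point @` nodes) z.
  move=> [t nt tz]; have [n tn Hn] := zapprox (fan t) (size t).+1.
  have : f n = t by apply: fan_point => j jt; rewrite Hn// tz.
  by move=> ft; have := sf n; rewrite ft leqNgt => /negP; apply.
pose l : compactification := exist _ z (mem_set cz).
have nl : (~` isolated_part) l by [].
exists (exist _ l (mem_set nl)) => j Fj.
have [n _ Hn] := zapprox [:: j] 0%N.
by rewrite /coord /= -Hn ?mem_head//; apply/pointP; exact: Ff.
Qed.

Lemma coord_continuous (j : cube_index) :
  continuous (fun x : growth => coord x j).
Proof.
move=> x; apply: (@continuous_comp _ _ _ (fun x : growth => val x)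
  (fun l : compactification => val l j)).
  exact: initial_continuous.
apply: (@continuous_comp _ _ _ (fun l : compactification => val l)
  (fun z : cube => z j)).
  exact: initial_continuous.
exact: cube_proj_continuous.
Qed.

Lemma coord_open (j : cube_index) b : open [set x : growth | coord x j = b].
Proof.
apply: (@open_comp _ _ (fun x : growth => coord x j) [set b]).
  by move=> x _; exact: coord_continuous.
exact: discrete_open.
Qed.

Lemma growth_nbhs (x : growth) (U : set growth) : nbhs x U ->
  exists F : seq cube_index, forall y,
    (forall j, j \in F -> coord y j = coord x j) -> U y.
Proof.
move=> [_ [[V oV <-] Vx VU]].
have : nbhs (val x) V by exact: open_nbhs_nbhs.
move=> [_ [[V' oV' <-] V'x VV']].
have /cube_nbhs[F HF] : nbhs (coord x) V' by exact: open_nbhs_nbhs.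
by exists F => y Hy; apply: VU; apply: VV'; exact: HF.
Qed.

Lemma compactification_compact : compact [set: compactification].
Proof.
apply: set_type_compact; apply: subclosed_compact cube_compact (@subsetT _ _).
exact: closed_closure.
Qed.

Lemma compactification_hausdorff : hausdorff_space compactification.
Proof. exact/set_type_hausdorff/cube_hausdorff. Qed.

Lemma isolated_point_open (l : compactification) : isolated_part l ->
  open [set l].
Proof.
move=> [t nt tl].
rewrite openE => _ ->; have : nbhs l (set_val @^-1` [set y : cube | forall j,
  j \in fan t -> y j = val l j]).
  exact/initial_continuous/cube_cylinder_nbhs.
apply: filterS => l' Hl'; apply: val_inj => /=; rewrite -tl.
apply: fan_isolated => [|j jt]; first exact/set_mem/(valP l').
by rewrite tl -Hl'.
Qed.

Lemma growth_compact_hausdorff : compact_hausdorff growth.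
Proof.
split; last exact/set_type_hausdorff/compactification_hausdorff.
apply: set_type_compact.
apply: subclosed_compact compactification_compact (@subsetT _ _).
apply: open_closedC; rewrite openE => l Wl.
apply: (@filterS _ _ _ [set l]); first by move=> _ ->.
by apply: open_nbhs_nbhs; split => //; exact: isolated_point_open.
Qed.

End Space.

(** * The pi-base *)

Section Properties.
Context (R : realType) (C : set (set nat)) (hC : unbounded_chain R C).
Local Notation growth := (growth R C).
Implicit Types (x y : growth) (t u : seq bool) (A B D : set nat).

Definition basic t A : set growth :=
  [set x | coord x (inl t) /\ coord x (inr A)].

Lemma basic_open t A : open (basic t A).
Proof. by apply: openI; exact: coord_open. Qed.

(** The long initial segments of [graft t (\bigcup_(A in F) A)] extend [t] and lie in all the trees
    [T_A] with [A] in [F]; they accumulate at a point of the growth. *)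
Lemma basic_neq0 t (F : set (set nat)) : F `<=` C ->
  (forall A, F A -> A `&` `I_(size t) `<=` ones t) ->
  small R (graft t (\bigcup_(A in F) A)) ->
  exists x, forall A, F A -> basic t A x.
Proof.
move=> FC Ft sF; pose f m := trunc (graft t (\bigcup_(A in F) A)) (size t + m).
have [|||x Hx] := @exists_growth R C f [set j | j = inl t \/ exists2 A,
  F A & j = inr A].
- move=> m; apply: subset_small sF; rewrite ones_trunc; exact: subIsetl.
- by move=> m; rewrite size_trunc leq_addl.
- move=> j m [->|[A FA ->]] /=; first by apply: prefix_trunc; exact: leq_addr.
  split; first exact: FC.
  apply: subtree_trunc => // k Ak; have [kt|tk] := ltnP k (size t).
    by left; exact: (Ft A).
  by right; split; [exists A|rewrite /= ltnNge tk].
- exists x => A FA; split; apply: Hx; first by left.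
  by right; exists A.
Qed.

Lemma basic1_neq0 t A : C A -> subtree R A t -> basic t A !=set0.
Proof.
move=> CA [At sA]; have [||| x Hx] := @basic_neq0 t [set A].
- by move=> _ ->.
- by move=> _ ->.
- by rewrite bigcup_set1.
- by exists x; exact: Hx.
Qed.

Lemma coord_set0 x : coord x (inr set0).
Proof.
have [t [nt _ Ht]] := growth_approx x [:: inr set0] 0%N.
rewrite Ht ?mem_head//; apply/pointP; split; first exact: (chain0 hC).
by rewrite subtree0E.
Qed.

Lemma coord_prefix x s t : prefix s t -> coord x (inl t) -> coord x (inl s).
Proof.
move=> st; have [u [_ _ Hu]] := growth_approx x [:: inl s; inl t] 0%N.
rewrite !Hu ?in_cons ?eqxx ?orbT// !point_cone; exact: prefix_trans.
Qed.

(** Reduces finitely many tree coordinates to one: [A0] is almost largest among the [A] in [F] whose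
    tree belongs to [x], and [m] bounds all exceptions and all lengths of cones. If there is no such
    [A], [set0] serves. *)
Lemma coord_max x (F : seq cube_index) : exists A0 m, coord x (inr A0) /\
  forall j, j \in F -> match j return Prop with
    | inl s => (size s <= m)%N
    | inr A => coord x (inr A) -> forall k, (m <= k)%N -> A k -> A0 k
    end.
Proof.
elim: F => [|j F [A0 [m [xA0 HF]]]]; first by exists set0, 0%N; split;
  [exact: coord_set0|].
case: j => [s|A].
  exists A0, (maxn m (size s)); split => // j; rewrite inE => /predU1P[->|/HF].
    exact: leq_maxr.
  case: j => [s'|A] H; first by rewrite leq_max H.
  by move=> xA k; rewrite geq_max => /andP[mk _]; exact: H.
have [xA|nxA] := boolP (coord x (inr A)); last first.
  exists A0, m; split => // j; rewrite inE => /predU1P[->|/HF//].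
  by move=> xA; rewrite xA in nxA.
have [[n An]|[n An]] :=
  chain_total hC (coord_subtree xA).1 (coord_subtree xA0).1.
  exists A0, (maxn m n); split => // j; rewrite inE => /predU1P[->|/HF].
    by move=> _ k; rewrite geq_max => /andP[_ nk]; exact: An.
  case: j => [s'|B] H; first by rewrite leq_max H.
  by move=> xB k; rewrite geq_max => /andP[mk _]; exact: H.
exists A, (maxn m n); split => // j; rewrite inE => /predU1P[->//|/HF].
case: j => [s'|B] H; first by rewrite leq_max H.
by move=> xB k; rewrite geq_max => /andP[mk nk] Bk; apply: An => //; exact: H.
Qed.

(** The set [D] is left free above [A]: the pi-base takes [D = A], while the countable local
    pi-bases use tails of one fixed [D]. *)
Lemma basic_nbhs x (U : set growth) : nbhs x U -> exists A t,
  [/\ C A, A `<=` branch x, subtree R A t &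
    forall u D, prefix t u -> subtree R A u -> A `\` `I_(size u) `<=` D ->
      basic u D `<=` U].
Proof.
move=> /growth_nbhs[F HF]; have [A [m [xA HA]]] := coord_max x F.
have [CA Ab] := coord_subtree xA.
have [t [nt mt Ht]] := growth_approx x (inr A :: F) m.
have tA : subtree R A t.
  by move: xA; rewrite Ht ?mem_head// => /pointP[].
exists A, t; split => // u D tu uA AD y [yu yD]; apply: HF => j jF.
(* The node [v] stands for [y]; it remains to see that [v] and [t] have the same coordinate [j]. *)
have [v [nv uv Hv]] := growth_approx y [:: j; inl u; inr D] (size u).
have {yu} uv' : prefix u v
  by rewrite -(point_cone R C) -(Hv (inl u)) ?inE ?eqxx ?orbT.
have {yD} vD : subtree R D v.
  by move: yD; rewrite Hv ?in_cons ?eqxx ?orbT// => /pointP[].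
have tv := prefix_trans tu uv'.
have vA : subtree R A v.
  apply: (@subtree_almost _ A D (size u)) => //.
    by move=> k uk Ak; apply: AD; split => //=; rewrite ltnNge uk.
  move=> k [Ak kv]; have [ku|uk] := ltnP k (size u).
    suff [] : (ones v `&` `I_(size u)) k by [].
    by rewrite -(prefix_ones uv'); apply: uA.1.
  by apply: vD.1; split => //; apply: AD; split => //=; rewrite ltnNge uk.
rewrite Hv ?mem_head// Ht ?in_cons ?jF ?orbT//.
case: j jF {Hv} => [s|B] jF.
  have sm : (size s <= size t)%N by apply: leq_trans mt; exact: HA jF.
  rewrite !point_cone; apply/idP/idP => [sv|st]; last exact: prefix_trans tv.
  apply/prefix_nthP; split => // k ks.
  move: tv => /prefix_nthP[_ <-]; last exact: leq_trans sm.
  by move: sv => /prefix_nthP[_ ->].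
apply/pointP/pointP => /=.
  by move=> [CB Bv]; split => //; apply: subtree_prefix Bv.
move=> [CB Bt]; split => //.
(* Since [T_B] belongs to [x], beyond [m] the set [B] is contained in [A], so membership of [v] in
   [T_A] passes to [T_B]. *)
have xB : coord x (inr B) by rewrite Ht ?in_cons ?jF ?orbT//; exact/pointP.
apply: (subtree_almost (HA _ jF xB) _ _ vA).
  by apply: leq_trans mt _; exact: size_prefix.
move=> k [Bk kv]; have [kt|tk] := ltnP k (size t).
  suff [] : (ones v `&` `I_(size t)) k by [].
  by rewrite -(prefix_ones tv); apply: Bt.1.
apply: vA.1; split => //; apply: (HA _ jF xB) => //; exact: leq_trans mt tk.
Qed.

Lemma basic_pi_base (U : set growth) : open U -> U !=set0 ->
  exists A t, [/\ C A, subtree R A t & basic t A `<=` U].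
Proof.
move=> oU [x Ux]; have [|A [t [CA _ tA H]]] := @basic_nbhs x U.
  exact: open_nbhs_nbhs.
by exists A, t; split => //; apply: H (prefix_refl t) tA _ => k [].
Qed.

(** A class is coded by a node [t] and a number [j]: beyond [t] each set has mass at most [1/(j+1)],
    and [n] such masses fit into the room left by [t]. *)
Lemma growth_sigma_n_linked n : sigma_n_linked n growth.
Proof.
pose linked t j A := [/\ C A, A `&` `I_(size t) `<=` ones t,
  forall m, mass (A `\` `I_(size t)) m <= j.+1%:R^-1 :> R &
  exists2 c : R, c < 1 & forall m, mass (ones t) m + n%:R * j.+1%:R^-1 <= c].
exists (fun m => [set U | [/\ open U, U !=set0 & exists t j A,
  [/\ m = pickle (t, j), linked t j A & basic t A `<=` U]]]); split.
  apply/seteqP; split=> [U [oU U0]|U [m _ [oU U0 _]]//].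
  have [A [t [CA tA AU]]] := basic_pi_base oU U0.
  have [At [c c1 Hc]] := tA.
  (* With this [j], [n] masses of size [1/(j+1)] take at most half of the room [1 - c]. *)
  pose j := Num.truncn (n%:R * 2 / (1 - c)).
  have jn : n%:R * j.+1%:R^-1 <= (1 - c) / 2.
    have : n%:R * 2 / (1 - c) < j.+1%:R by exact: truncnS_gt.
    by rewrite ltr_pdivrMr ?ler_pdivrMr//; lra.
  have j0 : 0 < j.+1%:R^-1 :> R by rewrite invr_gt0.
  have [m Hm] := light_tail (chain_light hC CA) j0.
  (* Moving up along [graft t A] costs no room and makes the rest of [A] as light as required. *)
  pose u := trunc (graft t A) (maxn (size t) m).
  have tu : prefix t u by apply: prefix_trunc; exact: leq_maxl.
  exists (pickle (u, j)) => //; split => //; exists u, j, A; split => //.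
  - have uA : subtree R A u by exact: subtree_ext.
    split => //; first exact: uA.1.
      move=> n'; apply: le_trans (Hm n'); apply: subset_mass => k [Ak].
      rewrite size_trunc /= => km; split => //= km'; apply: km.
      by rewrite leq_max km' orbT.
    exists (c + (1 - c) / 2); first by lra.
    move=> n'; apply: lerD => //; apply: le_trans (Hc n'); apply: subset_mass.
    by rewrite ones_trunc; exact: subIsetl.
  - by move=> x [xu xA]; apply: AU; split => //; exact: coord_prefix xu.
move=> m U HU; have [n0|n0] := posnP n.
  (* For [n = 0] the empty intersection is the whole growth, which is nonempty by the root and
     [set0]. *)
  suff [x] : [set: growth] !=set0 by exists x => i _; move: (ltn_ord i);
    rewrite [X in (_ < X)%N]n0.
  have [||x] := @basic1_neq0 [::] set0; [exact: (chain0 hC)| |by exists x].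
  rewrite subtree0E; exists 0 => // i; rewrite /mass big1// => k _.
  by rewrite memNset // /ones /= nth_nil.
have /choice[f Hf] i : exists p, [/\ m = pickle (p.1.1, p.1.2),
  linked p.1.1 p.1.2 p.2 & basic p.1.1 p.2 `<=` U i].
  by have [_ _ [t [j [A H]]]] := HU i; exists (t, j, A).
pose i0 := Ordinal n0.
have [e0 [_ _ _ [c c1 Hc]] _] := Hf i0.
set t := (f i0).1.1 in Hc; set j := (f i0).1.2 in Hc.
(* The code [m] determines the node and the number, so all [n] basic sets share them. *)
have ft i : (f i).1 = (t, j).
  have [e _ _] := Hf i; move: e; rewrite e0 => /(pcan_inj pickleK).
  by case: (f i) => [[? ?] ?] /= [] <- <-.
pose F := [set (f i).2 | i in [set: 'I_n]].
have [|||x Hx] := @basic_neq0 t F.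
- by move=> _ [i _ <-]; have [_ [] ] := Hf i.
- by move=> _ [i _ <-]; have [_ [] ] := Hf i; rewrite ft.
- exists c => // m'.
  apply: (@le_trans _ _ (mass (ones t `|` \bigcup_(i : 'I_n) ((f i).2 `\`
    `I_(size t))) m')).
    apply: subset_mass => k [tk|[[_ [i _ <-] Ak] kt]]; first by left.
    by right; exists i.
  apply: le_trans (massU _ _ _) _; apply: le_trans (Hc m'); rewrite lerD2l.
  apply: le_trans (mass_fin_bigcup _ _) _.
  apply: (@le_trans _ _ (\sum_(i < n) (j.+1%:R^-1 : R))).
    by apply: ler_sum => i _; have [_ [_ _ H _] _] := Hf i; move: H;
      rewrite ft; exact.
  by rewrite sumr_const card_ord mulr_natl.
- exists x => i _; have [_ _ H] := Hf i; apply: H; rewrite ft /=.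
  by apply: Hx; exists i.
Qed.

End Properties.

(** * Chain condition, density and pi-character *)

(** Two distinct members of a disjoint family cannot share a linked class, so the class index is
    injective on the family. *)
Lemma sigma_2_linked_ccc (K : topologicalType) : sigma_n_linked 2 K -> ccc K.
Proof.
move=> [L [HL Hlink]] F FK tF.
have /choice[f Hf] (U : set K) : exists m, F U -> L m U.
  have [FU|nFU] := pselect (F U); last by exists 0%N => /nFU.
  by have := FK _ FU; rewrite HL => -[m _ Lm]; exists m.
apply/countable_injP; exists f => U V /set_mem FU /set_mem FV fUV.
have [|x Hx] := Hlink (f U) (fun i : 'I_2 => if i == ord0 then U else V).
  by move=> i; case: ifP => _; [exact: Hf|rewrite fUV; exact: Hf].
apply: tF => //; exists x; split; first exact: (Hx ord0).
exact: (Hx ord_max).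
Qed.

Section Properties.
Context (R : realType) (C : set (set nat)) (hC : unbounded_chain R C).
Local Notation growth := (growth R C).
Local Notation basic := (@basic R C).
Implicit Types (x y : growth) (t u : seq bool) (A B D : set nat).

Lemma chain_setD A m : C A -> C (A `\` `I_m).
Proof.
move=> CA; apply: (chain_almost hC CA); last by apply: subset_almost => k [].
by exists m => k mk Ak; split => //=; rewrite ltnNge mk.
Qed.

(** Without a head [A] has mass at most 1/2, so the root lies in its tree. This gives a nonempty
    open set of points whose branches contain almost all of [A]. *)
Lemma basic_nil_neq0 A : C A -> exists m, basic [::] (A `\` `I_m) !=set0.
Proof.
move=> CA; have h : 0 < 2^-1 :> R by [].
have [m Hm] := light_tail (chain_light hC CA) h.
exists m; apply: basic1_neq0 => //; first exact: chain_setD.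
split => [k [_]//|]; exists 2^-1; first by lra.
move=> n; apply: le_trans (Hm n); apply: subset_mass => k [|[]//].
by rewrite /ones /= nth_nil.
Qed.

Lemma growth_non_separable : ~ separable growth.
Proof.
move=> [D /countable_injP[f finj] Ddense].
(* [E i] is the branch of the point of [D] numbered [i], and empty if there is none. *)
pose E i := [set k | exists2 x, D x /\ f x = i & branch x k].
have [B lB EB] : exists2 B, light R B & forall i, almost_subset (E i) B.
  apply: light_upper_bound => i.
  have [[x [Dx fx]]|nx] := pselect (exists x, D x /\ f x = i).
    apply: subset_light (light_branch x) => k [y [Dy fy]].
    by rewrite (finj y x) ?mem_set// fx.
  apply: subset_light (light_II 0) => k [y Hy]; case: nx; by exists y.
have [A CA] := chain_unbounded hC lB; apply.
have [m Am] := basic_nil_neq0 CA.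
have [x [[_ /coord_subtree[_ Ax]] Dx]] := Ddense _ Am (basic_open _ _ _ _).
apply: almost_subset_trans (EB (f x)).
by exists m => k mk Ak; exists x => //; apply: Ax; split => //=;
  rewrite ltnNge mk.
Qed.

(** Some [D] in [C] is not almost contained in the branch of [x]. It then lies above every [A] whose
    tree belongs to [x], so the countably many pairs of a node and a tail of [D] suffice. *)
Lemma growth_countable_pi_character : countable_pi_character growth.
Proof.
move=> x; have [D CD nDx] := chain_unbounded hC (light_branch x).
pose good := [set p : seq bool * nat | subtree R (D `\` `I_p.2) p.1].
exists [set basic p.1 (D `\` `I_p.2) | p in good]; split.
- exact: sub_countable (card_image_le _ _) (countableP _).
- move=> _ [[t m] tD <-]; split; first exact: basic_open.
  by apply: basic1_neq0 => //; exact: chain_setD.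
- move=> N /(basic_nbhs hC)[A [t [CA Ax tA HN]]].
  have [n AD] : almost_subset A D.
    have [//|DA] := chain_total hC CA CD.
    by case: nDx; exact: almost_subset_trans (subset_almost Ax).
  (* The tail of [D] beyond [m] must fit into the room left by [graft t A], and [m] must pass the
     place from which [A] is contained in [D]. *)
  have [m] := small_tail (maxn (size t) n) tA.2 (chain_light hC CD).
  rewrite geq_max => /andP[tm nm] sm; pose u := trunc (graft t A) m.
  have us : size u = m by exact: size_trunc.
  exists (basic u (D `\` `I_m)).
    exists (u, m) => //; split; rewrite /= ?us; first by move=> k [[]].
    apply: subset_small sm => k [|[]]; last by right.
    by rewrite ones_trunc => -[kA _]; left.
  apply: HN; [exact: prefix_trunc|exact: subtree_ext|].
  move=> k; rewrite us => -[Ak mk]; split => //; apply: AD => //.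
  by apply: leq_trans nm _; rewrite leqNgt; apply/negP.
Qed.

Lemma branch_open k : open [set x : growth | branch x k].
Proof.
have -> : [set x : growth | branch x k] =
    \bigcup_(s in [set s | size s = k.+1 /\ ones s k])
      [set x : growth | coord x (inl s) = true].
  by apply/seteqP; split => [x [s [? ? ?]]|x [s [? ?] ?]]; exists s.
by apply: bigcup_open => s _; exact: coord_open.
Qed.

Lemma growth_neq0 : [set: growth] !=set0.
Proof. by have [m [x _]] := basic_nil_neq0 (chain0 hC); exists x. Qed.

End Properties.

(** * Measures *)

(* Integrate the bound on the masses over [x]. *)
Lemma light_large_measure (d : measure_display) (T : measurableType d)
    (R : realType) (mu : {finite_measure set T -> \bar R})
    (N : nat -> set T) (e : R) :
  (forall k, measurable (N k)) ->
  (forall x m, mass [set k | N k x] m <= 1 :> R) -> 0 < e ->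
  light R [set k | (e%:E <= mu (N k))%E].
Proof.
move=> mN N1 e0; exists (fine (mu setT) / e) => m; rewrite ler_pdivlMr//.
have muT : mu setT \is a fin_num by exact: fin_num_measure.
have muN k : mu (N k) \is a fin_num by exact: fin_num_measure.
apply: (@le_trans _ _ (\sum_(k < m) (k.+1%:R^-1 * fine (mu (N k))))).
  rewrite mulr_suml; apply: ler_sum => k _; case: ifPn => [/set_mem/= ek|_].
    by rewrite ler_wpM2l// -lee_fin fineK.
  by rewrite mul0r mulr_ge0// fine_ge0.
rewrite -lee_fin fineK// -sumEFin.
rewrite (_ : (\sum_(i < m) _)%E = (\sum_(k <- enum 'I_m) \int[mu]_x (k.+1%:R^-1
  * \1_(N k) x)%:E)%E); last first.
  rewrite big_enum; apply: eq_bigr => k _.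
  under eq_integral do rewrite EFinM.
  rewrite ge0_integralZl//; last exact/measurable_EFinP.
  by rewrite integral_indic// setIT EFinM fineK.
have mw (k : 'I_m) : measurable_fun setT (fun x =>
  (k.+1%:R^-1 * \1_(N k) x)%:E).
  by apply/measurable_EFinP; exact: measurable_funM.
have w0 (k : 'I_m) (x : T) : (0 <= (k.+1%:R^-1 * \1_(N k) x)%:E)%E.
  by rewrite lee_fin mulr_ge0.
rewrite -ge0_integral_sum//.
rewrite -[leRHS]mul1e -integral_cst//; apply: ge0_le_integral => //=.
- by move=> x _; apply: sume_ge0 => k _; exact: w0.
- exact: emeasurable_sum.
- move=> x _; rewrite sumEFin lee_fin; apply: le_trans (N1 x m).
  rewrite /mass big_enum; apply: ler_sum => k _; rewrite indicE.
  rewrite (_ : (x \in N k) = ((k : nat) \in [set k | N k x])).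
    by case: ifP; rewrite ?mulr1 ?mulr0.
  by apply/idP/idP => /set_mem H; apply/mem_set.
Qed.

Section NoMeasure.
Context (R : realType) (C : set (set nat)) (hC : unbounded_chain R C).
Local Notation growth := (growth R C).

Definition pointed_growth (x0 : growth) : ptopologicalType :=
  HB.pack (set_type (~` @isolated_part R C))
    (isPointed.Build (set_type (~` @isolated_part R C)) x0).

(** A nonempty open set on which all branches contain a tail of [A] has measure at least some
    [1/(j+1)], which puts [A] almost inside the light set belonging to [j]. *)
Lemma growth_no_measure (x0 : growth) :
  ~ supports_measure R (pointed_growth x0).
Proof.
move=> [mu [_ mu0]].
pose N k : set (borel (pointed_growth x0)) := [set x : growth | branch x k].
have borel_open (U : set growth) : open U ->
  measurable (U : set (borel (pointed_growth x0))).
  by move=> oU; apply: sub_sigma_algebra.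
have [B lB EB] : exists2 B, light R B & forall j, almost_subset [set k |
  (((j.+1%:R^-1 : R)%:E <= mu (N k))%E : Prop)] B.
  apply: light_upper_bound => j; apply: light_large_measure => //.
  - by move=> k; apply: borel_open; exact: branch_open.
  - by move=> x m; exact: (@mass_branch R C x).
have [A CA] := chain_unbounded hC lB; apply.
have [m Am] := basic_nil_neq0 hC CA.
have oA := @basic_open R C [::] (A `\` `I_m).
have := mu0 _ oA Am.
set U := (basic _ _ : set (borel (pointed_growth x0))) => muU.
have mU : measurable U by exact: borel_open.
have fU : mu U \is a fin_num by exact: fin_num_measure.
(* Chosen so that [1/(j+1)] is below [mu U]. *)
pose j := Num.truncn (fine (mu U))^-1.
have jU : ((j.+1%:R^-1 : R)%:E <= mu U)%E.
  rewrite -(fineK fU) lee_fin -[leRHS]invrK lef_pV2 ?posrE// ?invr_gt0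
    ?fine_gt0//.
    exact/ltW/truncnS_gt.
  by rewrite muU ltey_eq fU.
apply: almost_subset_trans (EB j); exists m => k mk Ak /=.
apply: le_trans jU _; apply: le_measure; rewrite ?inE//.
  by apply: borel_open; exact: branch_open.
by move=> x [_ /coord_subtree[_]]; apply; split => //=; rewrite ltnNge mk.
Qed.

End NoMeasure.

(** * Fibers *)

Section OrderedCompact.
Variables (T : topologicalType) (le : rel T).
Hypotheses (le_anti : antisymmetric le) (le_trans : transitive le).
Hypothesis le_total : total le.

Let lt x y := (y != x) && le x y.

Let ordered : orderType (Order.Disp tt tt) :=
  HB.pack_for (orderType (Order.Disp tt tt)) (T : Type) (Choice.on T)
    (Order.isOrder.Build (Order.Disp tt tt) T (fun x y => erefl (lt x y))
      (fun x y => erefl (if lt x y then x else y))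
      (fun x y => erefl (if lt x y then y else x))
      le_anti le_trans le_total).

(* A continuous bijection from a compact space onto a Hausdorff one is a
   homeomorphism. *)
Lemma compact_linearly_ordered : compact [set: T] ->
  (forall x, open [set y | ~~ le x y]) ->
  (forall x, open [set y | ~~ le y x]) ->
  linearly_ordered_space T.
Proof.
move=> cT lo ro; pose O := order_topology ordered.
exists (Order.Disp tt tt), O.
pose f (x : T) : O := x.
have ltO (x y : T) : (f x < f y)%O = ~~ le y x by rewrite ltNge.
have fr (a : T) : open (f @^-1` `]f a, +oo[%classic).
  rewrite (_ : _ @^-1` _ = [set y | ~~ le y a])//.
  by apply/seteqP; split=> y; rewrite /preimage set_itvE /= ltO.
have fl (a : T) : open (f @^-1` `]-oo, f a[%classic).
  rewrite (_ : _ @^-1` _ = [set y | ~~ le a y])//.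
  by apply/seteqP; split=> y; rewrite /preimage set_itvE /= ltO.
have cf : continuous f.
  move=> x U; rewrite itv_nbhsE => -[i [oi xi] iU].
  have : open (f @^-1` [set` i]).
    case: i oi {xi iU} => [[[]a|[]] [[]b|[]]] // _.
    - by rewrite set_itv_splitI preimage_setI; exact: openI (fr a) (fl b).
    - exact: fr.
    - exact: fl.
    - by rewrite set_itvE preimage_setT; exact: openT.
  rewrite openE => /(_ x xi); apply: filterS => y yi; exact: iU.
exists f, (fun x : O => (x : T)); split => //.
apply/continuous_closedP => A cA.
suff : closed (f @` A) by rewrite (_ : f @` A = (fun x : O =>
  (x : T)) @^-1` A)// image_id.
apply: compact_closed; first exact: order_hausdorff.
apply: continuous_compact; first exact: continuous_subspaceT.
exact: subclosed_compact cA cT (@subsetT _ _).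
Qed.

End OrderedCompact.

(** * A metric on the sets of naturals *)

Definition cantor_metric (R : realType) : Type := set nat.

Section CantorMetric.
Context (R : realType).
Implicit Types X Y Z : set nat.

Definition differ X Y : pred nat := fun k => (k \in X) (+) (k \in Y).

Definition cantor_dist X Y : R :=
  if pselect (exists k,
    differ X Y k) is left h then (ex_minn h).+1%:R^-1 else 0.

Lemma cantor_dist_cases X Y : (X = Y /\ cantor_dist X Y = 0) \/
  exists2 k, cantor_dist X Y = k.+1%:R^-1 &
    differ X Y k /\ forall i, differ X Y i -> (k <= i)%N.
Proof.
rewrite /cantor_dist; case: pselect => [h|nh]; last first.
  left; split=> //; apply/seteqP; split => k kX; apply: contrapT => kY;
    apply: nh;
    by exists k; rewrite /differ (mem_set kX) memNset.
by right; case: ex_minnP => k dk kmin; exists k.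
Qed.

Lemma cantor_dist_le X Y n : (forall k, (k < n)%N -> X k <-> Y k) ->
  cantor_dist X Y <= n.+1%:R^-1.
Proof.
move=> H; have [[_ ->]|[k -> [dk _]]] := cantor_dist_cases X Y.
  by rewrite invr_ge0.
rewrite lef_pV2 ?posrE// ler_nat ltnS leqNgt; apply/negP => /H XY.
move: dk; rewrite /differ; case: (boolP (k \in X)) => [/set_mem/XY kY|/negP kX].
  by rewrite (mem_set kY).
by rewrite memNset// => /XY/mem_set.
Qed.

Lemma cantor_distxx X : cantor_dist X X = 0.
Proof.
have [[_ ->//]|[k _ [dk _]]] := cantor_dist_cases X X.
by move: dk; rewrite /differ addbb.
Qed.

Lemma cantor_dist_eq0 X Y : cantor_dist X Y = 0 -> X = Y.
Proof.
have [[->//]|[k -> _]] := cantor_dist_cases X Y.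
by move=> /eqP; rewrite invr_eq0 pnatr_eq0.
Qed.

Lemma cantor_dist_sym X Y : cantor_dist X Y = cantor_dist Y X.
Proof.
have dC k : differ X Y k = differ Y X k by rewrite /differ addbC.
have [[->//]|[k -> [dk kmin]]] := cantor_dist_cases X Y.
have [[YX _]|[i -> [di imin]]] := cantor_dist_cases Y X.
  by move: dk; rewrite YX /differ addbb.
suff -> : k = i by [].
by apply/eqP; rewrite eqn_leq imin -?dC// kmin ?dC.
Qed.

(** The first difference of [X] and [Z] is also a difference of [X] and [Y] or of [Y] and [Z]. *)
Lemma cantor_dist_triangle Y X Z :
  cantor_dist X Z <= cantor_dist X Y + cantor_dist Y Z.
Proof.
have d0 X' Y' : 0 <= cantor_dist X' Y'.
  by have [[_ ->//]|[k -> _]] := cantor_dist_cases X' Y'.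
have ge X' Y' k : differ X' Y' k -> k.+1%:R^-1 <= cantor_dist X' Y'.
  move=> dk; have [[e _]|[i -> [_ imin]]] := cantor_dist_cases X' Y'.
    by move: dk; rewrite e /differ addbb.
  by rewrite lef_pV2 ?posrE// ler_nat ltnS; exact: imin.
have [[_ ->]|[k -> [dk _]]] := cantor_dist_cases X Z; first by rewrite addr_ge0.
have [XY|XY] := boolP (differ X Y k).
  by rewrite (le_trans (ge _ _ _ XY))// lerDl.
rewrite (le_trans (ge Y Z k _)) ?lerDr//.
by move: dk XY; rewrite /differ; case: (k \in X); case: (k \in Y);
  case: (k \in Z).
Qed.

End CantorMetric.

(** The metric sits on an alias of [set nat] whose parameter [R] fixes the field of the
    distances. *)
HB.instance Definition _ (R : realType) := Choice.on (cantor_metric R).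
HB.instance Definition _ (R : realType) := isMetric.Build R (cantor_metric R)
  (@cantor_distxx R) (@cantor_dist_eq0 R) (@cantor_dist_sym R)
    (@cantor_dist_triangle R).

(** * The branch map and its fibers *)

Section Fibers.
Context (R : realType) (C : set (set nat)) (hC : unbounded_chain R C).
Local Notation growth := (growth R C).
Implicit Types (x y : growth) (A B : set nat).

Definition branch_map x : cantor_metric R := branch x.

Lemma branch_map_continuous : continuous branch_map.
Proof.
move=> x U /nbhs_ballP[e /= e0 eU].
pose n := Num.truncn e^-1.
have ne : n.+1%:R^-1 < e.
  by rewrite invf_plt ?posrE//; exact: truncnS_gt.
(* On the cone of [s] all branches agree below [n], hence are closer than [e]. *)
pose s := trunc (branch x) n.
have : nbhs x [set y | coord y (inl s) = true].
  apply: open_nbhs_nbhs; split; first exact: coord_open.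
  by apply/coord_cone; rewrite ones_trunc size_trunc.
apply: filterS => y /coord_cone; rewrite ones_trunc size_trunc => xy.
apply: eU; rewrite ballEmdist /=; apply: le_lt_trans ne.
apply: cantor_dist_le => k kn; split => [kx|ky].
  suff [] : (branch y `&` `I_n) k by [].
  by rewrite -xy.
suff [] : (branch x `&` `I_n) k by [].
by rewrite xy.
Qed.

Lemma growth_eq x y : branch x = branch y ->
  (forall A, coord x (inr A) <-> coord y (inr A)) -> x = y.
Proof.
move=> bxy Axy; do 2!apply: val_inj; apply: functional_extensionality_dep =>
  -[s|A].
  apply/idP/idP => /coord_cone; first by rewrite bxy => /coord_cone.
  by rewrite -bxy => /coord_cone.
by apply/idP/idP => /Axy.
Qed.

(** A long node approximating [x] contains [A] below [m] because the branch does, and beyond [m]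
    because it contains [B]. So it passes from [T_B] to [T_A]. *)
Lemma coord_downward x A B : C A -> A `<=` branch x -> almost_subset A B ->
  coord x (inr B) -> coord x (inr A).
Proof.
move=> CA Ax [m AB]; have [t [_ mt Ht xt]] := growth_branch_approx x [:: inr A;
  inr B] m.
rewrite !Ht ?in_cons ?eqxx ?orbT// => /pointP[_ tB]; apply/pointP; split => //.
apply: (subtree_almost AB) => // k [Ak kt]; have [km|mk] := ltnP k m.
  suff [] : (ones t `&` `I_m) k by [].
  by rewrite -xt; split => //; exact: Ax.
by apply: tB.1; split => //; exact: AB.
Qed.

Lemma fiber_total x y : branch x = branch y ->
  (forall A, coord x (inr A) -> coord y (inr A)) \/
  (forall A, coord y (inr A) -> coord x (inr A)).
Proof.
move=> bxy; have [|nxy] := pselect (forall A, coord x (inr A) ->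
  coord y (inr A)).
  by left.
have [A [xA nyA]] : exists A, coord x (inr A) /\ ~ coord y (inr A).
  apply: contrapT => H; apply: nxy => A xA; apply: contrapT => nyA.
  by apply: H; exists A.
right => B yB; have [CA Ax] := coord_subtree xA; have [CB By] :=
  coord_subtree yB.
have [AB|BA] := chain_total hC CA CB.
  by case: nyA; apply: (coord_downward CA _ AB yB); rewrite -bxy.
by apply: (coord_downward CB _ BA xA); rewrite bxy.
Qed.

Local Notation fiber X := (set_type (branch_map @^-1` [set X])).

Lemma fiber_coord_open (X : cantor_metric R) (A : set nat) b :
  open [set p : fiber X | coord (val p) (inr A) = b].
Proof.
apply: (@open_comp _ _ (fun p : fiber X => val p) [set x |
  coord x (inr A) = b]).
  by move=> p _; exact: initial_continuous.
exact: coord_open.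
Qed.

Lemma fiber_branch (X : cantor_metric R) (p : fiber X) : branch (val p) = X.
Proof. exact: (set_mem (valP p)). Qed.

Lemma growth_linearly_fibered : linearly_fibered R growth.
Proof.
exists (cantor_metric R), branch_map; split; first exact: branch_map_continuous.
(* The fiber is ordered by inclusion of the families of those [A] whose tree belongs to the
   point. *)
move=> X; pose le : rel (fiber X) := fun p q =>
  `[< forall A, coord (val p) (inr A) -> coord (val q) (inr A) >].
apply: (@compact_linearly_ordered _ le).
- move=> p q /andP[/asboolP pq /asboolP qp]; apply: val_inj; apply: growth_eq.
    by rewrite !fiber_branch.
  by move=> A; split; [exact: pq|exact: qp].
- by move=> q p r /asboolP pq /asboolP qr; apply/asboolP => A /pq/qr.
- move=> p q; have [|H|H] := @fiber_total (val p) (val q).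
  + by rewrite !fiber_branch.
  + by apply/orP; left; exact/asboolP.
  + by apply/orP; right; exact/asboolP.
- apply: set_type_compact;
    apply: subclosed_compact (@growth_compact_hausdorff R C).1 (@subsetT _ _).
  apply: closed_comp => [x _|]; first exact: branch_map_continuous.
  by apply: accessible_closed_set1; apply: hausdorff_accessible;
    exact: metric_hausdorff.
- move=> p; rewrite (_ : [set _ | _] = \bigcup_(A in [set A |
    coord (val p) (inr A)])
      [set q | coord (val q) (inr A) = false]).
    by apply: bigcup_open => A _; exact: fiber_coord_open.
  apply/seteqP; split => q /=.
    move=> /asboolPn H; apply: contrapT => nH; apply: H => A pA.
    by apply/negPn/negP => /negbTE qA; apply: nH; exists A.
  by move=> [A /= pA qA]; apply/asboolPn => /(_ A pA); rewrite qA.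
- move=> p; rewrite (_ : [set _ | _] = \bigcup_(A in [set A |
    coord (val p) (inr A) = false])
      [set q | coord (val q) (inr A) = true]).
    by apply: bigcup_open => A _; exact: fiber_coord_open.
  apply/seteqP; split => q /=.
    move=> /asboolPn H; apply: contrapT => nH; apply: H => A qA.
    by apply/negPn/negP => /negbTE pA; apply: nH; exists A.
  by move=> [A /= pA qA]; apply/asboolPn => /(_ A qA); rewrite pA.
Qed.

Lemma growth_scatteredly_fibered : scatteredly_fibered R growth.
Proof.
exists (cantor_metric R), branch_map; split; first exact: branch_map_continuous.
move=> X S [p0 Sp0].
(* If no [A] separates two points of [S], then [S] is a single point. Otherwise the points of [S]
   outside the least separating tree coordinate [D] turn out to coincide. *)
pose split_by A := (exists2 p, S p & coord (val p) (inr A)) /\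
  (exists2 p, S p & coord (val p) (inr A) = false).
have [[A HA]|nA] := pselect (exists A, split_by A); last first.
  exists p0; split; first exact: mem_set.
  exists setT; first exact: filterT.
  apply/seteqP; split => [p [_ Sp]|_ -> //].
  apply: val_inj; apply: growth_eq; first by rewrite !fiber_branch.
  move=> A; split => pA; apply/negPn/negP => /negbTE qA; apply: nA; exists A.
    by split; [exists p|exists p0].
  by split; [exists p0|exists p].
have [||D [[p1 Sp1 p1D] [p Sp pD]] Dmin] := chain_well hC (S := split_by).
- by move=> B [[p _ /coord_subtree[]]].
- by exists A.
have [CD DX] := coord_subtree p1D; rewrite fiber_branch in DX.
exists p; split; first exact: mem_set.
exists [set q | coord (val q) (inr D) = false].
  by apply: open_nbhs_nbhs; split => //; exact: fiber_coord_open.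
apply/seteqP; split => [q [qD Sq]|_ -> //].
(* A coordinate [B] telling [q1] and [q2] apart would lie above [D], and by downward closure [q1]
   would have the coordinate [D] as well. *)
have sub (q1 q2 : fiber X) B : S q1 -> S q2 -> coord (val q1) (inr D) = false ->
    coord (val q1) (inr B) -> coord (val q2) (inr B).
  move=> Sq1 Sq2 q1D q1B; apply/negPn/negP => /negbTE q2B.
  have DB : almost_subset D B by apply: Dmin; split; [exists q1|exists q2].
  suff : coord (val q1) (inr D) by rewrite q1D.
  by apply: (coord_downward CD _ DB q1B); rewrite fiber_branch.
apply: val_inj; apply: growth_eq; first by rewrite !fiber_branch.
by move=> B; split; exact: sub.
Qed.

End Fibers.

(** * The growth of omega *)

Lemma homeomorphic_refl (T : topologicalType) : homeomorphic T T.
Proof. by exists id, id; split => // x; exact: cvg_id. Qed.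

Section Growth.
Context (R : realType) (C : set (set nat)).

Lemma isolated_part_dense : dense (@isolated_part R C).
Proof.
move=> U [l +] [V oV VU]; rewrite -{U}VU => Vl.
have [_ [[t nt <-] Vt]] := set_mem (valP l) V (open_nbhs_nbhs (conj oV Vl)).
exists (exist _ (node_point R C t) (mem_set (point_compactification nt))).
by split; [|exists t].
Qed.

Lemma isolated_part_homeomorphic :
  homeomorphic nat (set_type (@isolated_part R C)).
Proof.
have nodes0 m : nodes R (trunc set0 m).
  rewrite /nodes /= ones_trunc set0I; exists 0 => // n.
  by rewrite /mass big1// => k _; rewrite in_set0.
(* The finite sequences of zeros are infinitely many nodes. *)
have nodes_inf : infinite_set (nodes R).
  apply: (sub_infinite_set (A := range (trunc set0))); first by move=>
    _ [m _ <-].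
  apply/infiniteP; have /inj_card_eq : {in [set: nat] &,
    injective (trunc set0)}.
    by move=> m n _ _ /(congr1 size); rewrite !size_trunc.
  by rewrite card_eq_le => /andP[].
have /card_set_bijP[q [_ qinj qsurj]] :=
  eq_card_nat (countableP (nodes R)) nodes_inf.
have /choice[g gq] n : exists t, nodes R t /\ q t = n.
  by have [t nt qt] := qsurj n Logic.I; exists t.
have gn n : nodes R (g n) := (gq n).1.
have cg n : compactification R C (node_point R C (g n)).
  exact: point_compactification.
pose l n : compactification R C :=
  exist _ (node_point R C (g n)) (mem_set (cg n)).
have Wl n : isolated_part (l n) by exists (g n).
pose f n : set_type (@isolated_part R C) := exist _ (l n) (mem_set (Wl n)).
have fsurj w : exists n, f n = w.
  have [t nt tw] := set_mem (valP w); exists (q t); do 2!apply: val_inj;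
    rewrite /= -tw.
  by congr (node_point _ _ _); apply: qinj;
    [exact: mem_set|exact: mem_set|exact: (gq _).2].
have finj : injective f.
  move=> m n /(congr1 (fun w => val (val w))) /= /point_inj e.
  by rewrite -(gq m).2 e (gq n).2.
have /choice[h fh] := fsurj.
exists f, h; split => //; first by move=> n; apply: finj.
  by apply/continuousP => U _; exact: discrete_open.
move=> w U hU.
(* The inverse is continuous because the points of the isolated part are open. *)
have : nbhs w (set_val @^-1` [set val w]).
  apply: initial_continuous; apply: open_nbhs_nbhs; split => //.
  exact/isolated_point_open/(set_mem (valP w)).
by apply: filterS => v /val_inj ->; exact: nbhs_singleton hU.
Qed.

Lemma growth_homeomorphic : homeomorphic_to_growth_of_omega (growth R C).
Proof.
exists (compactification R C), (@isolated_part R C).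
split; last exact: homeomorphic_refl.
split; last exact: isolated_part_dense.
  by split; [exact: compactification_compact|exact: compactification_hausdorff].
exact: isolated_part_homeomorphic.
Qed.

End Growth.

(** * The growth has all the required properties *)

Theorem theorem5p18 (R : realType) :
  exists K : ptopologicalType,
    compact_hausdorff K /\
    homeomorphic_to_growth_of_omega K /\
    ~ separable K /\
    ccc K /\
    (linearly_fibered R K /\ scatteredly_fibered R K) /\
    countable_pi_character K /\
    ~ supports_measure R K /\
    (forall n : nat, (1 <= n)%N -> sigma_n_linked n K).
Proof.
have [C hC] := exists_unbounded_chain R.
have [x0 _] := growth_neq0 hC.
exists (pointed_growth x0).
split; first exact: growth_compact_hausdorff.
split; first exact: growth_homeomorphic.
split; first exact: (growth_non_separable hC).
split; first exact/sigma_2_linked_ccc/(growth_sigma_n_linked hC 2).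
split; first by split;
  [exact: growth_linearly_fibered|exact: growth_scatteredly_fibered].
split; first exact: (growth_countable_pi_character hC).
split; first exact: (growth_no_measure hC).
by move=> n _; exact: (growth_sigma_n_linked hC n).
Qed.
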